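(* The following conditions are equivalent for a monoid $H$: (a) $H$ is unit-cancellative and satisfies the ACCPR and the ACCPL. (b) $H$ is acyclic and satisfies the ACCP. Moreover, each of these conditions implies that every non-unit of $H$ factors as a (non-empty, finite) product of atoms.
   Context: A monoid is a semigroup with identity $1_H$, written multiplicatively, not assumed commutative or cancellative. $H^\times$ is the set of units, i.e. (two-sided) invertible elements; a non-unit is an element not in $H^\times$. $H$ is unit-cancellative if $xy \ne x \ne yx$ for all $x, y \in H$ with $y \notin H^\times$. $H$ is acyclic if $uxv \ne x$ for all $u, v, x \in H$ with $u \notin H^\times$ or $v \notin H^\times$. $H$ satisfies the ACCPR (resp. ACCPL, ACCP) if there is no infinite sequence of sets of the form $aH$ (resp. $Ha$, $HaH$) with $a \in H$ that is strictly increasing with respect to inclusion. An atom of $H$ is a non-unit $a \in H$ such that $a \ne xy$ for all non-units $x, y \in H$. *)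

(* Defs.v *)
From mathcomp Require Import all_boot.
From mathcomp Require Import monoid.
From mathcomp Require Import classical_sets.

Set Implicit Arguments.
Unset Strict Implicit.
Unset Printing Implicit Defensive.

Local Open Scope group_scope.
Local Open Scope classical_set_scope.

Section Defs.
Variable H : monoidType.
Implicit Types (a u v x y : H).

Definition is_unit x : Prop := exists y, x * y = 1 /\ y * x = 1.

Definition unit_cancellative : Prop :=
  forall x y, ~ is_unit y -> x * y <> x /\ x <> y * x.

Definition acyclic : Prop :=
  forall u v x, ~ is_unit u \/ ~ is_unit v -> u * x * v <> x.

Definition principal_right a : set H := [set a * x | x in [set: H]].

Definition principal_left a : set H := [set x * a | x in [set: H]].

Definition principal_twosided a : set H :=
  [set u * a * v | u in [set: H] & v in [set: H]].

Definition ACC_on (I : H -> set H) : Prop :=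
  ~ exists S : nat -> set H,
      (forall n, exists a, S n = I a) /\ (forall n, S n `<` S n.+1).

Definition ACCPR : Prop := ACC_on principal_right.
Definition ACCPL : Prop := ACC_on principal_left.
Definition ACCP : Prop := ACC_on principal_twosided.

Definition atom a : Prop :=
  ~ is_unit a /\ forall x y, ~ is_unit x -> ~ is_unit y -> a <> x * y.

Definition product_of_atoms x : Prop :=
  exists s : seq H,
    [/\ s <> [::], forall a, a \in s -> atom a & x = \prod_(a <- s) a].

End Defs.

Arguments unit_cancellative : clear implicits.
Arguments acyclic : clear implicits.
Arguments ACCPR : clear implicits.
Arguments ACCPL : clear implicits.
Arguments ACCP : clear implicits.

(* Main.v *)
Require Import Defs.
From mathcomp Require Import all_boot.
From mathcomp Require Import monoid.
From mathcomp Require Import boolp classical_sets.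

(** Everything rests on one observation about a unit-cancellative monoid: if
    [b = b' * v] and the inclusion of right ideals which this gives is not
    strict, say [b' = b * w], then [b' = b' * (v * w)], so [v * w] is a unit;
    since one-sided inverses are two-sided in such a monoid ([mulg_eq1_unit]),
    [v] is a unit as well. So along an ascending chain of principal right ideals
    given by [b_n = b_(n+1) * v_n], the ACCPR makes the cofactors [v_n] units
    from some point on; dually for left ideals.

    (a) implies (b): let [a_n = u_n * a_(n+1) * v_n] be any ascending chain of
    principal two-sided ideals. Absorbing the accumulated left cofactors turns
    it into a chain of right ideals, [b_n = u_0 ... u_(n-1) * a_n] with
    [b_n = b_(n+1) * v_n], and symmetrically on the other side. Hence [u_n] and
    [v_n] are both units for some common [n] ([two_sided_cofactors_unit]). For
    constant sequences this is acyclicity; in general it says that the chain is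
    not strictly increasing, which is the ACCP.

    (b) implies (a): an acyclic monoid is unit-cancellative (take one of the two
    outer factors to be [1]). A chain [a_n = a_(n+1) * v_n] of right ideals is
    also a chain of two-sided ideals, so the ACCP gives an [n] with
    [a_(n+1) = u * a_(n+1) * (v_n * w)] for some [u] and [w]; acyclicity makes
    [v_n * w], hence [v_n], a unit.

    Factorisation is proved from (b): a non-unit without a factorisation into
    atoms is a product of two non-units, one of which has no factorisation
    either, and acyclicity makes the two-sided ideal of that factor strictly
    larger. Iterating contradicts the ACCP. *)

Set Implicit Arguments.
Unset Strict Implicit.
Unset Printing Implicit Defensive.

Local Open Scope group_scope.
Local Open Scope classical_set_scope.

Section Monoid.
Variable H : monoidType.
Implicit Types (a b u v x y : H).

(** * Principal ideals and ascending chains *)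

Lemma principal_right_subset a b :
  principal_right a `<=` principal_right b <-> exists x, a = b * x.
Proof.
split=> [sub|[x ->] _ [y _ <-]]; last by exists (x * y); rewrite ?mulgA.
have [|x _ <-] := sub a; first by exists 1; rewrite ?mulg1.
by exists x.
Qed.

Lemma principal_left_subset a b :
  principal_left a `<=` principal_left b <-> exists x, a = x * b.
Proof.
split=> [sub|[x ->] _ [y _ <-]]; last by exists (y * x); rewrite ?mulgA.
have [|x _ <-] := sub a; first by exists 1; rewrite ?mul1g.
by exists x.
Qed.

Lemma principal_twosided_subset a b :
  principal_twosided a `<=` principal_twosided b <->
  exists u v, a = u * b * v.
Proof.
split=> [sub|[u [v ->]] _ [x _ [y _ <-]]].
  have [|u _ [v _ <-]] := sub a; last by exists u, v.
  by exists 1 => //; exists 1; rewrite // mul1g mulg1.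
by exists (x * u) => //; exists (v * y) => //; rewrite !mulgA.
Qed.

(** An ascending chain which moves infinitely often has a strictly increasing
    subsequence, so the absence of the latter, which is how the chain conditions
    are stated, yields eventual stationarity rather than one stationary step.
    The stronger form lets two chains be stationary at a common index. *)
Lemma ACC_eventually_stationary (I : H -> set H) (a : nat -> H) :
    ACC_on I -> (forall n, I (a n) `<=` I (a n.+1)) ->
  exists N, forall n, N <= n -> I (a n.+1) `<=` I (a n).
Proof.
move=> acc chain; apply: contrapT => moving; apply: acc.
have /choice[f f_moves] N : exists n, N <= n /\ ~ I (a n.+1) `<=` I (a n).
  apply: contrapT => stuck; apply: moving; exists N => n Nn.
  by apply: contrapT => strict; apply: stuck; exists n.
have mono m n : m <= n -> I (a m) `<=` I (a n).
  move=> /subnK <-; elim: (n - m)%N => [|k IH] //.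
  by rewrite addSn; apply: subset_trans IH (chain _).
pose g k := iter k (fun n => (f n).+1) 0.
exists (fun k => I (a (g k))); split=> k; first by exists (a (g k)).
have [le_f f_strict] := f_moves (g k).
split; first exact/mono/leqW.
by move=> back; apply: f_strict; apply: subset_trans back (mono _ _ le_f).
Qed.

Lemma ACC_stationary (I : H -> set H) (a : nat -> H) :
    ACC_on I -> (forall n, I (a n) `<=` I (a n.+1)) ->
  exists n, I (a n.+1) `<=` I (a n).
Proof.
move=> acc chain; have [N stat] := ACC_eventually_stationary acc chain.
by exists N; apply: stat.
Qed.

Lemma ACC_from_generators (I : H -> set H) :
    (forall a : nat -> H, (forall n, I (a n) `<=` I (a n.+1)) ->
      exists n, I (a n.+1) `<=` I (a n)) ->
  ACC_on I.
Proof.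
move=> stat [S [/choice[a Sa] Sinc]].
have [|n] := stat a; first by move=> n; rewrite -!Sa; case: (Sinc n).
by rewrite -!Sa; case: (Sinc n).
Qed.

(** * From one-sided to two-sided chain conditions *)

Section UnitCancellative.
Hypothesis uc : unit_cancellative H.

Lemma mulg_fixr_unit x y : x * y = x -> is_unit y.
Proof. by move=> xy; apply: contrapT => /(uc x)[]. Qed.

Lemma mulg_fixl_unit x y : y * x = x -> is_unit y.
Proof. by move=> yx; apply: contrapT => /(uc x)[_]; rewrite yx. Qed.

(** From [x * y = 1] one gets [x * (y * x) = x], so [y * x] is an invertible
    idempotent, that is, [1]. *)
Lemma mulg_eq1_unit x y : x * y = 1 -> is_unit x /\ is_unit y.
Proof.
move=> xy; have [z [yxz _]] : is_unit (y * x).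
  by apply: (@mulg_fixr_unit x); rewrite mulgA xy mul1g.
have yx : y * x = 1.
  have xz : x * z = x by rewrite -[LHS]mul1g -{1}xy -!mulgA (mulgA y) yxz mulg1.
  by rewrite -yxz -mulgA xz.
by split; [exists y | exists x].
Qed.

Lemma mulg_unit x y : is_unit (x * y) -> is_unit x /\ is_unit y.
Proof.
move=> [z [xyz zxy]]; split.
  by have [] := @mulg_eq1_unit x (y * z) _; first by rewrite mulgA.
by have [] := @mulg_eq1_unit (z * x) y _; first by rewrite -mulgA.
Qed.

Lemma right_cofactors_eventually_unit (b v : nat -> H) :
    ACCPR H -> (forall n, b n = b n.+1 * v n) ->
  exists N, forall n, N <= n -> is_unit (v n).
Proof.
move=> acc bv.
have [|N stat] := ACC_eventually_stationary (a := b) acc.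
  by move=> n; apply/principal_right_subset; exists (v n).
exists N => n /stat /principal_right_subset[w bw].
have /mulg_unit[] // : is_unit (v n * w).
by apply: (@mulg_fixr_unit (b n.+1)); rewrite mulgA -bv.
Qed.

Lemma left_cofactors_eventually_unit (b u : nat -> H) :
    ACCPL H -> (forall n, b n = u n * b n.+1) ->
  exists N, forall n, N <= n -> is_unit (u n).
Proof.
move=> acc ub.
have [|N stat] := ACC_eventually_stationary (a := b) acc.
  by move=> n; apply/principal_left_subset; exists (u n).
exists N => n /stat /principal_left_subset[w wb].
have /mulg_unit[] // : is_unit (w * u n).
by apply: (@mulg_fixl_unit (b n.+1)); rewrite -mulgA -ub.
Qed.

(** A two-sided chain splits into one-sided chains: multiplying [a n] by the left
    cofactors already used up leaves only the right cofactors to account for,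
    and conversely. *)
Lemma two_sided_cofactors_unit (a u v : nat -> H) :
    ACCPR H -> ACCPL H -> (forall n, a n = u n * a n.+1 * v n) ->
  exists n, is_unit (u n) /\ is_unit (v n).
Proof.
move=> accr accl uav.
pose lprod n := iteri n (fun i p => p * u i) 1.
pose rprod n := iteri n (fun i p => v i * p) 1.
have [|N1 vunit] :=
  @right_cofactors_eventually_unit (fun n => lprod n * a n) v accr.
  by move=> n; rewrite [in LHS]uav /= !mulgA.
have [|N2 uunit] :=
  @left_cofactors_eventually_unit (fun n => a n * rprod n) u accl.
  by move=> n; rewrite [in LHS]uav /= !mulgA.
exists (maxn N1 N2); split; first exact/uunit/leq_maxr.
exact/vunit/leq_maxl.
Qed.

Lemma acyclic_of_ACCPR_ACCPL : ACCPR H -> ACCPL H -> acyclic H.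
Proof.
move=> accr accl u v x nonunit uxv.
have [//|_ [uu vu]] :=
  @two_sided_cofactors_unit
    (fun=> x) (fun=> u) (fun=> v) accr accl _.
by case: nonunit.
Qed.

Lemma ACCP_of_ACCPR_ACCPL : ACCPR H -> ACCPL H -> ACCP H.
Proof.
move=> accr accl; apply: ACC_from_generators => a chain.
have /choice[u /choice[v uav]] n : exists u v, a n = u * a n.+1 * v.
  exact/principal_twosided_subset.
have [n [[u' [_ u'u]] [v' [vv' _]]]] :=
  two_sided_cofactors_unit accr accl uav.
exists n; apply/principal_twosided_subset; exists u', v'.
by rewrite (uav n) !mulgA u'u mul1g -mulgA vv' mulg1.
Qed.

End UnitCancellative.

(** * Acyclic monoids with the ACCP *)

Section Acyclic.
Hypothesis acyc : acyclic H.

Lemma acyclic_fix_unit u v x : u * x * v = x -> is_unit u /\ is_unit v.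
Proof.
by move=> uxv; split; apply: contrapT => nu; apply: (acyc _ uxv); [left|right].
Qed.

Lemma acyclic_unit_cancellative : unit_cancellative H.
Proof.
move=> x y ny; split=> xy.
  by apply: (acyc (u := 1) (v := y) (x := x)); [right | rewrite mul1g].
by apply: (acyc (u := y) (v := 1) (x := x)); [left | rewrite mulg1].
Qed.

Lemma ACCPR_of_ACCP : ACCP H -> ACCPR H.
Proof.
move=> accp; apply: ACC_from_generators => a chain.
have /choice[v av] n : exists v, a n = a n.+1 * v.
  exact/principal_right_subset.
have [|n] := ACC_stationary (a := a) accp.
  move=> n; apply/principal_twosided_subset; exists 1, (v n).
  by rewrite mul1g.
move=> /principal_twosided_subset[u [w uaw]]; exists n.
have [_ /(mulg_unit acyclic_unit_cancellative)[[v' [vv' _]] _]] :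
    is_unit u /\ is_unit (v n * w).
  by apply: (@acyclic_fix_unit _ _ (a n.+1)); rewrite [RHS]uaw (av n) !mulgA.
by apply/principal_right_subset; exists v'; rewrite (av n) -mulgA vv' mulg1.
Qed.

Lemma ACCPL_of_ACCP : ACCP H -> ACCPL H.
Proof.
move=> accp; apply: ACC_from_generators => a chain.
have /choice[u ua] n : exists u, a n = u * a n.+1.
  exact/principal_left_subset.
have [|n] := ACC_stationary (a := a) accp.
  move=> n; apply/principal_twosided_subset; exists (u n), 1.
  by rewrite mulg1.
move=> /principal_twosided_subset[w [v wav]]; exists n.
have [/(mulg_unit acyclic_unit_cancellative)[_ [u' [_ u'u]]] _] :
    is_unit (w * u n) /\ is_unit v.
  by apply: (@acyclic_fix_unit _ _ (a n.+1)); rewrite [RHS]wav (ua n) !mulgA.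
by apply/principal_left_subset; exists u'; rewrite (ua n) mulgA u'u mul1g.
Qed.

(** * Factorisation into atoms *)

Lemma product_of_atoms_mul x y :
  product_of_atoms x -> product_of_atoms y -> product_of_atoms (x * y).
Proof.
move=> [s [s0 sA ->]] [t [_ tA ->]]; exists (s ++ t); split.
- by case: s s0 {sA}.
- by move=> a; rewrite mem_cat => /orP[/sA|/tA].
- by rewrite big_cat.
Qed.

(** A strictly larger two-sided ideal comes with passing to a proper factor: were
    [y = u * (y * z) * v], acyclicity would make [z * v] a unit. *)
Lemma larger_ideal_without_factorisation x :
    ~ is_unit x -> ~ product_of_atoms x ->
  exists y, [/\ ~ is_unit y, ~ product_of_atoms y &
    principal_twosided x `<` principal_twosided y].
Proof.
move=> xN xF; have uc := acyclic_unit_cancellative.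
have [y [z [yN zN xyz]]] :
    exists y z, [/\ ~ is_unit y, ~ is_unit z & x = y * z].
  apply: contrapT => irr; apply: xF; exists [:: x]; split=> // [a|].
    rewrite inE => /eqP ->; split=> // y z yN zN xyz.
    by apply: irr; exists y, z.
  by rewrite big_seq1.
have [yF|yF] := pselect (product_of_atoms y); last first.
  exists y; split=> //; split.
    by apply/principal_twosided_subset; exists 1, z; rewrite mul1g.
  move=> /principal_twosided_subset[u [v yE]]; apply: zN.
  have [_ /(mulg_unit uc)[]//] : is_unit u /\ is_unit (z * v).
  by apply: (@acyclic_fix_unit _ _ y); rewrite [RHS]yE xyz !mulgA.
exists z; split=> //; first by move=> /(product_of_atoms_mul yF); rewrite -xyz.
split; first by apply/principal_twosided_subset; exists y, 1; rewrite mulg1.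
move=> /principal_twosided_subset[u [v zE]]; apply: yN.
have [/(mulg_unit uc)[]//] : is_unit (u * y) /\ is_unit v.
by apply: (@acyclic_fix_unit _ _ z); rewrite [RHS]zE xyz !mulgA.
Qed.

Lemma factorisation_of_ACCP x : ACCP H -> ~ is_unit x -> product_of_atoms x.
Proof.
move=> accp xN; apply: contrapT => xF; apply: accp.
pose bad y := ~ is_unit y /\ ~ product_of_atoms y.
(* [choice] needs a total relation, so elements that are not bad get an arbitrary image. *)
have /choice[f f_bad] y : exists z, bad y ->
    bad z /\ principal_twosided y `<` principal_twosided z.
  have [[yN yF]|yG] := pselect (bad y); last by exists y.
  by have [z []] := larger_ideal_without_factorisation yN yF; exists z.
have iter_bad n : bad (iter n f x) by elim: n => //= n /(f_bad _)[].
exists (fun n => principal_twosided (iter n f x)).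
by split=> n; [exists (iter n f x) | have [] := f_bad _ (iter_bad n)].
Qed.

End Acyclic.

End Monoid.

(** * Equivalence of the one-sided and two-sided conditions *)

Theorem corollary4p6 (H : monoidType) :
  let cond_a := unit_cancellative H /\ ACCPR H /\ ACCPL H in
  let cond_b := acyclic H /\ ACCP H in
  let factors := forall x : H, ~ is_unit x -> product_of_atoms x in
  (cond_a <-> cond_b) /\ (cond_a -> factors) /\ (cond_b -> factors).
Proof.
move=> cond_a cond_b factors.
have ab : cond_a -> cond_b.
  move=> [uc [accr accl]].
  by split; [apply: acyclic_of_ACCPR_ACCPL | apply: ACCP_of_ACCPR_ACCPL].
have ba : cond_b -> cond_a.
  move=> [acyc accp]; split; first exact: acyclic_unit_cancellative.
  by split; [apply: ACCPR_of_ACCP | apply: ACCPL_of_ACCP].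
have bf : cond_b -> factors.
  by move=> [acyc accp] x; apply: factorisation_of_ACCP.
by split; [split | split=> // /ab].
Qed.
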